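(* Let $S$ be a balanced parentheses sequence of length $n$, and let $\alpha$ be any one of the following measures of repetitiveness of $S$: the size $\gamma$ of a string attractor, the size $g$ of a Straight-Line Program, the size $g_{rl}$ of a run-length SLP, the size $c$ of a collage system, the number $z$ of phrases of the LZ77 parse, or the size $b$ of a macro scheme. Then $\Omega(\log n/\log\log n)$ time is needed to perform each of the operations excess, findopen, findclose, fwd\_search, bwd\_search, rmq/RMQ, rmqi/RMQi on $S$ with any static data structure using $O(\alpha\,\mathrm{polylog}\,n)$ space.
   Context: Operations on a balanced parentheses string $S$: (1) $excess(i)$ = number of open minus closed parentheses in $S[1..i]$; (2) $findclose(i)$ = position of the closed parenthesis matching the open parenthesis at $i$; (3) $findopen(i)$ = its inverse (position of the open parenthesis matching the closed one at $i$); (4) $fwd\_search(i,d)$ = first position $j>i$ with $excess(j)=excess(i)+d$; (5) $bwd\_search(i,d)$ = the same searching backwards; (6) $rmq(i,j)$/$RMQ(i,j)$ = minimum/maximum of $excess(i..j)$; (7) $rmqi(i,j)$/$RMQi(i,j)$ = leftmost position of a minimum/maximum of $excess(i..j)$. A string attractor of $S\in\Sigma^n$ is a set $\Gamma\subseteq[1..n]$ such that every substring $S[i..j]$ has an occurrence $S[i'..j']=S[i..j]$ containing some position of $\Gamma$. An SLP is a context-free grammar generating exactly one string with rules $X\to AB$, size = number of nonterminals; a run-length SLP also allows $X\to A^k$; collage systems, LZ77 and macro schemes are the standard dictionary-compression schemes, sizes being their numbers of rules/phrases. Space is measured in words of $O(\log n)$ bits. *)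

(* Defs.v *)
(* MathComp + MathComp-Analysis; the latter only for the real logarithm [ln]. *)
From mathcomp Require Import all_boot all_order all_algebra.
From mathcomp Require Import reals exp.

Set Implicit Arguments.
Unset Strict Implicit.
Unset Printing Implicit Defensive.

Import Order.TTheory GRing.Theory Num.Theory.
Local Open Scope ring_scope.

(** ** Balanced parentheses *)

(* A parentheses string is a [seq bool], [true] being the open parenthesis.
   Positions run from 1 to [size S]: S[i] is [nth _ S i.-1] and S[1..i] is
   [take i S]. *)

Definition excess (S : seq bool) (i : nat) : int :=
  (count_mem true (take i S))%:Z - (count_mem false (take i S))%:Z.

Definition balanced (S : seq bool) : bool :=
  (excess S (size S) == 0) && all (fun i => 0 <= excess S i) (iota 1 (size S)).

(* The argument of [balanced] below is S[i+1..j-1]. *)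
Definition matching (S : seq bool) (i j : nat) : Prop :=
  [/\ (0 < i < j)%N, (j <= size S)%N, nth false S i.-1 = true,
      nth true S j.-1 = false & balanced (take (j - i).-1 (drop i S))].

Inductive operation :=
  | Excess | FindClose | FindOpen | FwdSearch | BwdSearch
  | RangeMin | RangeMax | RangeMinPos | RangeMaxPos.

Definition query (op : operation) : Type :=
  match op with
  | Excess | FindClose | FindOpen => nat
  | FwdSearch | BwdSearch => (nat * int)%type
  | RangeMin | RangeMax | RangeMinPos | RangeMaxPos => (nat * nat)%type
  end.

Definition answer (op : operation) : Type :=
  match op with
  | Excess | RangeMin | RangeMax => int
  | FindClose | FindOpen | FwdSearch | BwdSearch
  | RangeMinPos | RangeMaxPos => nat
  end.

(* [op_spec op S q a]: query [q] is meaningful on [S] and its answer is [a].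
   It holds for no [a] when the arguments are out of range or when no position
   of S satisfies the search condition. *)
Definition op_spec (op : operation) (S : seq bool) :
    query op -> answer op -> Prop :=
  match op return query op -> answer op -> Prop with
  | Excess => fun i a => (1 <= i <= size S)%N /\ a = excess S i
  | FindClose => fun i j => matching S i j
  | FindOpen => fun j i => matching S i j
  | FwdSearch => fun q j => let: (i, d) := q in
      [/\ (1 <= i < j)%N, (j <= size S)%N, excess S j = excess S i + d
        & forall k, (i < k < j)%N -> excess S k <> excess S i + d]
  | BwdSearch => fun q j => let: (i, d) := q in
      [/\ (1 <= j < i)%N, (i <= size S)%N, excess S j = excess S i + d
        & forall k, (j < k < i)%N -> excess S k <> excess S i + d]
  | RangeMin => fun q a => let: (i, j) := q in
      [/\ (1 <= i)%N && (j <= size S)%N,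
          exists2 k, (i <= k <= j)%N & a = excess S k
        & forall k, (i <= k <= j)%N -> a <= excess S k]
  | RangeMax => fun q a => let: (i, j) := q in
      [/\ (1 <= i)%N && (j <= size S)%N,
          exists2 k, (i <= k <= j)%N & a = excess S k
        & forall k, (i <= k <= j)%N -> excess S k <= a]
  | RangeMinPos => fun q p => let: (i, j) := q in
      [/\ (1 <= i)%N && (j <= size S)%N, (i <= p <= j)%N,
          forall k, (i <= k <= j)%N -> excess S p <= excess S k
        & forall k, (i <= k < p)%N -> excess S p < excess S k]
  | RangeMaxPos => fun q p => let: (i, j) := q in
      [/\ (1 <= i)%N && (j <= size S)%N, (i <= p <= j)%N,
          forall k, (i <= k <= j)%N -> excess S k <= excess S p
        & forall k, (i <= k < p)%N -> excess S k < excess S p]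
  end.

(** ** Measures of repetitiveness *)

(* In this part positions are counted from 0. *)

Section Repetitiveness.
Variable T : eqType.
Implicit Type S : seq T.

Definition substr S (i l : nat) : seq T := take l (drop i S).

Definition attractor S (G : {set 'I_(size S)}) : Prop :=
  forall i l, (0 < l)%N -> (i + l <= size S)%N ->
    exists i', [/\ (i' + l <= size S)%N, substr S i' l = substr S i l
                 & exists2 p : 'I_(size S), p \in G & (i' <= p < i' + l)%N].

(* Right-hand sides of rules; a symbol is a terminal [inl a] or a nonterminal
   [inr X].  [Substring A l r] stands for the substring A[l..r] of the
   expansion of A, with l and r counted from 1. *)
Inductive rhs (k : nat) :=
  | Concat of T + 'I_k & T + 'I_k
  | Power of T + 'I_k & nat
  | Substring of T + 'I_k & nat & nat.

(* One rule for each nonterminal; cyclic rules are not excluded here, but a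
   nonterminal that depends on itself derives no string. *)
Inductive derives k (rule : 'I_k -> rhs k) : T + 'I_k -> seq T -> Prop :=
  | derives_terminal a : derives rule (inl a) [:: a]
  | derives_concat X A B u v : rule X = Concat A B ->
      derives rule A u -> derives rule B v -> derives rule (inr X) (u ++ v)
  | derives_power X A e u : rule X = Power A e ->
      derives rule A u -> derives rule (inr X) (flatten (nseq e u))
  | derives_substring X A l r u : rule X = Substring A l r ->
      derives rule A u -> (1 <= l <= r)%N -> (r <= size u)%N ->
      derives rule (inr X) (substr u l.-1 (r - l.-1)).

Definition slp_rule k (r : rhs k) : bool :=
  if r is Concat _ _ then true else false.

Definition rlslp_rule k (r : rhs k) : bool :=
  match r with
  | Concat _ _ => true | Power _ e => (0 < e)%N | Substring _ _ _ => false
  end.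

Definition collage_rule k (r : rhs k) : bool :=
  match r with
  | Concat _ _ => true | Power _ e => (0 < e)%N | Substring _ _ _ => true
  end.

Definition generated_by (allowed : forall k, rhs k -> bool) S (k : nat) : Prop :=
  exists (rule : 'I_k -> rhs k) (start : 'I_k),
    (forall X, allowed k (rule X)) /\
    (forall s, derives rule (inr start) s <-> s = S).

(* Overlapping sources are allowed. *)
Definition occurs_before S (i l : nat) : Prop :=
  (i + l <= size S)%N /\ exists2 i', (i' < i)%N & substr S i' l = substr S i l.

(* Greedy parse: a phrase is the longest prefix of the rest of S with an
   occurrence starting earlier, or a single symbol if that prefix is empty. *)
Definition lz77_parse S (phrases : seq (seq T)) : Prop :=
  flatten phrases = S /\
  forall ps p qs, phrases = ps ++ p :: qs ->
    let i := size (flatten ps) in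
    [/\ (0 < size p)%N, size p = 1%N \/ occurs_before S i (size p)
      & ~ occurs_before S i (size p).+1].

(* [CopyFrom src l] copies the text at positions src, ..., src + l - 1, on
   either side of the phrase. *)
Inductive directive := Explicit of T | CopyFrom of nat & nat.

Definition directive_size (d : directive) : nat :=
  if d is CopyFrom _ l then l else 1%N.

Definition directives_size (ds : seq directive) : nat :=
  sumn (map directive_size ds).

(* [decodes ds p a]: following the copies from position p ends at an explicit
   symbol a. *)
Inductive decodes (ds : seq directive) : nat -> T -> Prop :=
  | decodes_explicit ds1 a ds2 : ds = ds1 ++ Explicit a :: ds2 ->
      decodes ds (directives_size ds1) a
  | decodes_copy ds1 src l ds2 o a : ds = ds1 ++ CopyFrom src l :: ds2 ->
      (o < l)%N -> decodes ds (src + o) a ->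
      decodes ds (directives_size ds1 + o) a.

Definition macro_scheme S (ds : seq directive) : Prop :=
  directives_size ds = size S /\
  forall p a, decodes ds p a <-> onth S p = Some a.

End Repetitiveness.

Inductive repetitiveness :=
  | Attractor | SLP | RunLengthSLP | CollageSystem | LZ77 | MacroScheme.

(* [has_size alpha S a]: S has a representation of kind [alpha] of size [a].
   The measure itself is the least such [a] (there is at most one for LZ77). *)
Definition has_size (alpha : repetitiveness) (S : seq bool) (a : nat) : Prop :=
  match alpha with
  | Attractor =>
      exists2 G : {set 'I_(size S)}, attractor G & #|G| = a
  | SLP => generated_by (@slp_rule _) S a
  | RunLengthSLP => generated_by (@rlslp_rule _) S a
  | CollageSystem => generated_by (@collage_rule _) S a
  | LZ77 => exists2 ps, lz77_parse S ps & size ps = a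
  | MacroScheme => exists2 ds, macro_scheme S ds & size ds = a
  end.

Definition measure_value (alpha : repetitiveness) (S : seq bool) (a : nat) :=
  has_size alpha S a /\ forall b, has_size alpha S b -> (a <= b)%N.

(** ** Static data structures in the cell-probe model *)

(* An adaptive algorithm reading cells with contents in [W]; computation
   between two reads is free and unrestricted. *)
Inductive probe_tree (W A : Type) :=
  | Return of A
  | Probe of nat & (W -> probe_tree W A).

Fixpoint run W A (mem : nat -> W) (t : probe_tree W A) : A :=
  match t with
  | Return a => a
  | Probe addr next => run mem (next (mem addr))
  end.

Fixpoint probes W A (mem : nat -> W) (t : probe_tree W A) : nat :=
  match t with
  | Return _ => 0
  | Probe addr next => (probes mem (next (mem addr))).+1
  end.

(* The length n of the string is known to the query algorithm at no cost. *)
Record static_ds (Q A : Type) := StaticDS {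
  word_size : nat -> nat;
  memory : forall S : seq bool, seq ((word_size (size S)).-tuple bool);
  query_alg : forall n : nat, Q -> probe_tree ((word_size n).-tuple bool) A
}.

(* Cells beyond the used space read as zero. *)
Definition cell Q A (D : static_ds Q A) (S : seq bool) (addr : nat) :
    (word_size D (size S)).-tuple bool :=
  nth [tuple of nseq _ false] (memory D S) addr.

Definition ds_answer Q A (D : static_ds Q A) (S : seq bool) (q : Q) : A :=
  run (cell D S) (query_alg D (size S) q).

Definition query_time Q A (D : static_ds Q A) (S : seq bool) (q : Q) : nat :=
  probes (cell D S) (query_alg D (size S) q).

Definition supports (op : operation)
    (D : static_ds (query op) (answer op)) : Prop :=
  forall (S : seq bool) (q : query op) (a : answer op),
    balanced S -> op_spec S q a -> ds_answer D S q = a.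

Definition logarithmic_words (R : realType) Q A (D : static_ds Q A) : Prop :=
  exists (K : R) (n1 : nat), forall n, (n1 <= n)%N ->
    (word_size D n)%:R <= K * ln n%:R.

(* Space is counted in words. *)
Definition polylog_space (R : realType) (alpha : repetitiveness) Q A
    (D : static_ds Q A) : Prop :=
  exists (K : R) (c n1 : nat), forall (S : seq bool) (a : nat),
    balanced S -> (n1 <= size S)%N -> measure_value alpha S a ->
    (size (memory D S))%:R <= K * a%:R * ln (size S)%:R ^+ c.

(* Main.v *)
(* A bit string indexed by the digit vectors (y_1, ..., y_C), y_i < m, whose bit
   at y is the exclusive or of C table entries f_i(y_i), has an SLP of size
   O(C m), whatever the tables f_i are.  Writing each bit as a block "(())" or
   "()()" turns it into a balanced string on which a single query of any of the
   operations reads off one bit.  Take m = polylog n and m^C close to n, so that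
   C is of order log n / log log n and the space is polylog n.  For each f, the
   queries making t probes use only polylog(n)^t address sequences.  If t is a
   small constant times C, some address sequence serves so many queries that
   some coordinate y_i takes many different values in them; the answers to these
   queries, hence as many bits of f, are determined by the contents of only t
   cells.  This is too little information for all tables f. *)

Require Import Defs.
From mathcomp Require Import all_boot all_order all_algebra.
From mathcomp Require Import reals exp.
From mathcomp Require boolp.
From mathcomp Require Import zify ring lra.

Set Implicit Arguments.
Unset Strict Implicit.
Unset Printing Implicit Defensive.

Import Order.TTheory GRing.Theory Num.Theory.

(** * Grammars as lists of strings *)

(** A nonterminal is identified with the string it derives, so a grammar is a plain list of strings;
    the terminals are the strings of length one. *)
Definition symbol (T : eqType) (G : seq (seq T)) (w : seq T) : bool :=
  (w \in G) || (size w == 1).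

Definition splits (T : eqType) (G : seq (seq T)) (w : seq T) (j : nat) : bool :=
  [&& 0 < j < size w, symbol G (take j w) & symbol G (drop j w)].

(** Both pieces of a split are shorter than the whole, so no cyclic rule can arise. *)
Definition grammar (T : eqType) (G : seq (seq T)) : Prop :=
  forall w, w \in G -> exists j, splits G w j.

Lemma grammar_size_gt1 (T : eqType) (G : seq (seq T)) w :
  grammar G -> w \in G -> 1 < size w.
Proof. by move=> gG /gG[j /and3P[/andP[]]] *; lia. Qed.

Lemma symbol_size_gt0 (T : eqType) (G : seq (seq T)) w :
  grammar G -> symbol G w -> 0 < size w.
Proof. by move=> gG /orP[/(grammar_size_gt1 gG)|/eqP]; lia. Qed.

Lemma sub_symbol (T : eqType) (G G' : seq (seq T)) w :
  {subset G <= G'} -> symbol G w -> symbol G' w.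
Proof. by move=> sub /orP[/sub|]; rewrite /symbol => ->; rewrite ?orbT. Qed.

Lemma splits_cat (T : eqType) (G : seq (seq T)) u v :
  grammar G -> symbol G u -> symbol G v -> splits G (u ++ v) (size u).
Proof.
move=> gG su sv; rewrite /splits take_size_cat // drop_size_cat // su sv size_cat.
by have := symbol_size_gt0 gG su; have := symbol_size_gt0 gG sv; lia.
Qed.

Lemma sub_splits (T : eqType) (G G' : seq (seq T)) w j :
  {subset G <= G'} -> splits G w j -> splits G' w j.
Proof.
by move=> sub /and3P[lt_j s1 s2]; apply/and3P; split=> //; apply: sub_symbol sub _.
Qed.

Lemma grammar_cons (T : eqType) (G : seq (seq T)) u v :
  grammar G -> symbol G u -> symbol G v -> grammar ((u ++ v) :: G).
Proof.
have sub : {subset G <= (u ++ v) :: G} by move=> x; rewrite inE => ->; rewrite orbT.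
move=> gG su sv w; rewrite inE => /orP[/eqP->|/gG[j]].
  by exists (size u); apply: (sub_splits sub); apply: splits_cat.
by move/(sub_splits sub); exists j.
Qed.

Lemma grammar_flatten (T : eqType) (G : seq (seq T)) us :
    grammar G -> all (symbol G) us -> 0 < size us ->
  exists G', [/\ grammar G', {subset G <= G'}, symbol G' (flatten us)
    & size G' <= size G + size us].
Proof.
move=> gG; elim: us => // u [|v us] IH /=.
  by rewrite cats0 andbT => su _; exists G; split=> //; lia.
case/andP=> su sus _; have [G' [gG' sub sf szG']] := IH sus isT.
exists ((u ++ flatten (v :: us)) :: G'); split=> [|||] /=.
- by apply: grammar_cons => //; apply: sub_symbol su.
- by move=> x /sub; rewrite inE => ->; rewrite orbT.
- by rewrite /symbol inE eqxx.
- by move: szG' => /=; lia.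
Qed.

(** Binary exponentiation: each bit of [k] costs one doubling and at most one extra factor [u]. *)
Lemma grammar_repeat (T : eqType) (G : seq (seq T)) u l k :
    grammar G -> symbol G u -> 0 < k < 2 ^ l ->
  exists G', [/\ grammar G', {subset G <= G'}, symbol G' (flatten (nseq k u))
    & size G' <= size G + 2 * l].
Proof.
move=> gG su; elim: l k => [k|l IH k]; first by rewrite expn0; lia.
rewrite expnS => lk; have [k1|k1] := leqP k 1.
  have -> : k = 1 by lia.
  by exists G; rewrite /= cats0; split=> //; lia.
have [|G1 [gG1 sub1 s1 sz1]] := IH k./2; first by lia.
set h := flatten _ in s1.
have sub2 : {subset G1 <= (h ++ h) :: G1} by move=> x; rewrite inE orbC => ->.
have gG2 : grammar ((h ++ h) :: G1) by apply: grammar_cons.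
have s2 : symbol ((h ++ h) :: G1) (h ++ h) by rewrite /symbol inE eqxx.
have hE : flatten (nseq k./2.*2 u) = h ++ h.
  by rewrite -addnn nseqD flatten_cat.
have [odd_k|even_k] := boolP (odd k); last first.
  exists ((h ++ h) :: G1); split=> //=; last by lia.
    by move=> x /sub1; apply: sub2.
  have -> : k = k./2.*2 by lia.
  by rewrite hE.
exists ((u ++ h ++ h) :: (h ++ h) :: G1); split=> /=; last by lia.
- by apply: grammar_cons => //; apply: sub_symbol su => x /sub1; apply: sub2.
- by move=> x /sub1/sub2; rewrite !inE => ->; rewrite orbT.
- have -> : k = k./2.*2.+1 by lia.
  by rewrite /= hE /symbol inE eqxx.
Qed.

(* [X] is a default, reached only for the empty string. *)
Definition nonterminal (T : eqType) (G : seq (seq T)) (X : 'I_(size G))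
    (w : seq T) : T + 'I_(size G) :=
  if insub (index w G) is Some Y then inr Y
  else if w is x :: _ then inl x else inr X.

Definition expansion (T : eqType) (G : seq (seq T)) (A : T + 'I_(size G)) :=
  match A with inl a => [:: a] | inr X => nth [::] G X end.

Lemma expansion_nonterminal (T : eqType) (G : seq (seq T)) X w :
  symbol G w -> expansion (@nonterminal T G X w) = w.
Proof.
rewrite /symbol /nonterminal -index_mem; case: insubP => [Y lt_w val_Y _|].
  by rewrite /= val_Y nth_index // -index_mem.
by move=> /negPf-> /=; case: w => [|x []].
Qed.

(** The rules come from one chosen split per string. Induction on derivations shows that nothing but
    [S] is derived, induction on the length that [S] is. *)
Lemma grammar_slp (T : eqType) (G : seq (seq T)) S :
  grammar G -> S \in G -> generated_by (@slp_rule T) S (size G).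
Proof.
move=> gG SG.
have {}gG (X : 'I_(size G)) : exists j, splits G (nth [::] G X) j.
  by apply: gG; rewrite mem_nth.
pose w (X : 'I_(size G)) := nth [::] G X; pose j X := xchoose (gG X).
pose rule X : rhs T (size G) :=
  Concat (nonterminal X (take (j X) (w X))) (nonterminal X (drop (j X) (w X))).
have rule_expansion A s : derives rule A s -> s = expansion A.
  elim=> [a //|X A1 A2 u v [<- <-] _ -> _ ->|//|//].
  have /and3P[_ s1 s2] := xchooseP (gG X).
  by rewrite !expansion_nonterminal // cat_take_drop.
have derives_symbol X u : symbol G u -> derives rule (nonterminal X u) u.
  have [N] := ubnP (size u); elim: N u X => // N IH u X ltN su.
  rewrite /nonterminal; case: insubP => [Y _ val_Y|].
    have wY : w Y = u.
      rewrite /w val_Y nth_index // -index_mem -val_Y; exact: ltn_ord.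
    have /and3P[lt_j s1 s2] : splits G (w Y) (j Y) := xchooseP (gG Y).
    rewrite -wY in ltN *; rewrite -(cat_take_drop (j Y) (w Y)).
    apply: (derives_concat (erefl (rule Y))).
      by apply: IH s1; rewrite size_take; case: ifP; lia.
    by apply: IH s2; rewrite size_drop; lia.
  rewrite index_mem; move: su; rewrite /symbol => /orP[->//|].
  by case: u ltN => [|x []] //= *; constructor.
have lt_S : index S G < size G by rewrite index_mem.
exists rule, (Ordinal lt_S); split=> // s; split=> [/rule_expansion /= ->|->].
  by rewrite nth_index.
have := derives_symbol (Ordinal lt_S) S; rewrite /symbol SG => /(_ isT).
rewrite /nonterminal; case: insubP => [Y _ val_Y|/negP//].
by congr (derives _ (inr _) _); apply: val_inj.
Qed.

Lemma generated_by_sub (T : eqType) (P Q : forall k, rhs T k -> bool) S k :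
  (forall k r, P k r -> Q k r) -> generated_by P S k -> generated_by Q S k.
Proof. by move=> PQ [rule [X [allowed]]]; exists rule, X; split=> // Y; exact/PQ. Qed.

(** * From grammars to the other measures *)

Lemma substr_substr (T : eqType) (S : seq T) i l o k :
  o + k <= l -> substr (substr S i l) o k = substr S (i + o) k.
Proof.
move=> le_l; rewrite /substr take_drop take_takel; last by lia.
by rewrite -take_drop drop_drop addnC.
Qed.

Lemma onth_substr (T : eqType) (S : seq T) i l o :
  o < l -> onth (substr S i l) o = onth S (i + o).
Proof.
move=> lt_o; rewrite !onthE /substr map_take map_drop nth_take //.
by rewrite nth_drop.
Qed.

Lemma occurs_before_sub (T : eqType) (S : seq T) i l i' l' :
  i <= i' -> i' + l' <= i + l -> occurs_before S i l -> occurs_before S i' l'.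
Proof.
move=> le_i le_l [le_S [src lt_src eq_src]]; split; first by lia.
exists (src + (i' - i)); first by lia.
have -> : substr S i' l' = substr (substr S i l) (i' - i) l'.
  by rewrite substr_substr; [congr substr|]; lia.
by rewrite -eq_src substr_substr //; lia.
Qed.

(** * Parses that copy from the left *)

Definition backward (T : eqType) (S : seq T) (i : nat) (d : directive T) : Prop :=
  match d with
  | Explicit a => onth S i = Some a
  | CopyFrom src l =>
      [/\ src < i, i + l <= size S & substr S src l = substr S i l]
  end.

(** This one kind of parse yields an attractor, a macro scheme and a bound for LZ77. *)
Fixpoint backward_parse (T : eqType) (S : seq T) (i : nat)
    (ds : seq (directive T)) : Prop :=
  if ds is d :: ds' then
    backward S i d /\ backward_parse S (i + directive_size d) ds'
  else True.

Lemma backward_parse_cat (T : eqType) (S : seq T) i ds1 ds2 :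
  backward_parse S i (ds1 ++ ds2) <->
  backward_parse S i ds1 /\ backward_parse S (i + directives_size ds1) ds2.
Proof.
elim: ds1 i => [|d ds1 IH] i /=; first by rewrite /directives_size /= addn0; tauto.
by rewrite IH /directives_size /= addnA; tauto.
Qed.

Lemma directives_locate (T : eqType) (ds : seq (directive T)) p :
  p < directives_size ds ->
  exists ds1 d ds2 o, [/\ ds = ds1 ++ d :: ds2, o < directive_size d
    & p = directives_size ds1 + o].
Proof.
elim: ds p => [//|d ds IH] p; rewrite /directives_size /= => lt_p.
have [lt_d|le_d] := ltnP p (directive_size d).
  by exists [::], d, ds, p.
have [|ds1 [d' [ds2 [o [-> lt_o eq_p]]]]] := IH (p - directive_size d).
  by rewrite /directives_size; lia.
exists (d :: ds1), d', ds2, o; split=> //=.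
by move: eq_p; rewrite /directives_size /=; lia.
Qed.

Lemma backward_parse_mid (T : eqType) (S : seq T) ds1 d ds2 :
  backward_parse S 0 (ds1 ++ d :: ds2) -> backward S (directives_size ds1) d.
Proof. by move/backward_parse_cat=> [_ []]. Qed.

(* [V] holds the nonterminals expanded so far: each of them is expanded once and
   copied from then on, so the parse tree has at most [size G] inner nodes. *)
Lemma grammar_backward_parse_aux (T : eqType) (G V : seq (seq T)) S w i :
    grammar G -> symbol G w -> i + size w <= size S ->
    substr S i (size w) = w -> uniq V -> {subset V <= G} ->
    {in V, forall v, exists2 src, src + size v <= i & substr S src (size v) = v} ->
  exists ds (V' : seq (seq T)),
    [/\ backward_parse S i ds, directives_size ds = size w
      & size ds + size V <= size V' + 1] /\
    [/\ uniq V', {subset V' <= G}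
      & {in V', forall v, (exists2 src, src + size v <= i + size w
                                      & substr S src (size v) = v)
                         /\ (v \in V \/ size v <= size w)}].
Proof.
move=> gG; have [N] := ubnP (size w).
elim: N w i V => // N IH w i V ltN sw le_S eq_w uV sV occV.
have widen v : v \in V ->
  exists2 src, src + size v <= i + size w & substr S src (size v) = v.
  by move/occV=> [src le_src eq_src]; exists src => //; lia.
have [wV|wV] := boolP (w \in V).
  have [src le_src eq_src] := occV w wV.
  exists [:: CopyFrom T src (size w)], V; split.
    rewrite /directives_size /= addn0; split=> //; last by lia.
    have := symbol_size_gt0 gG sw; split=> //; split=> //; first by lia.
    by rewrite eq_src.
  by split=> // v vV; split; [apply: widen | left].
move: (sw) => /orP[wG|/eqP w1]; last first.
  have [a def_w] : exists a, w = [:: a].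
    by case: w w1 {ltN sw le_S eq_w wV widen} => [|a []] // _; exists a.
  exists [:: Explicit a], V; split; last first.
    by split=> // v vV; split; [apply: widen | left].
  rewrite /directives_size /= w1; split=> //; last by lia.
  split=> //; rewrite -[i]addn0 -(@onth_substr _ _ _ 1) // -w1 eq_w def_w //.
have [j /and3P[lt_j su sv]] := gG w wG.
have szu : size (take j w) = j by rewrite size_take; case: ifP; lia.
have szv : size (drop j w) = size w - j by rewrite size_drop.
have [|||ds1 [V1 [[p1 dsz1 cnt1] [uV1 sV1 occV1]]]] :=
    IH _ i V _ su _ _ uV sV occV; try by rewrite szu; lia.
  by rewrite szu -[RHS](congr1 (take j) eq_w) /substr take_takel //; lia.
rewrite szu in dsz1 occV1.
have [||||ds2 [V2 [[p2 dsz2 cnt2] [uV2 sV2 occV2]]]] :=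
    IH _ (i + j) V1 _ sv _ _ uV1 sV1 _; try by rewrite szv; lia.
- rewrite szv -[RHS](congr1 (drop j) eq_w) /substr addnC -drop_drop take_drop.
  by rewrite subnK //; lia.
- by move=> v /occV1[].
rewrite szv in dsz2 occV2.
(* The count compares leaves and inner nodes of a binary tree: the phrases are the leaves, the
   strings added to [V] the inner nodes. *)
exists (ds1 ++ ds2), (w :: V2); split.
  split=> /=; last by rewrite size_cat; lia.
    by apply/backward_parse_cat; split=> //; rewrite dsz1.
  by rewrite /directives_size map_cat sumn_cat -!/(directives_size _) dsz1 dsz2; lia.
split=> /=.
(* Strings added since [V] are no longer than a piece of [w], hence shorter than [w]; the size
   clause of the conclusion serves this purpose. *)
- rewrite uV2 andbT; apply/negP => /occV2[_ []]; last by lia.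
  by move/occV1=> [_ []]; [exact/negP | lia].
- by move=> v; rewrite inE => /orP[/eqP->|/sV2].
move=> v; rewrite inE => /orP[/eqP->|/occV2[[src le_src eq_src] v2]].
  by split; [exists i | right].
split; first by exists src => //; lia.
case: v2 => [/occV1[_ []]|]; [by left | by right; lia | by right; lia].
Qed.

Lemma grammar_backward_parse (T : eqType) (G : seq (seq T)) S :
    grammar G -> S \in G ->
  exists ds, [/\ backward_parse S 0 ds, directives_size ds = size S
    & size ds <= size G + 1].
Proof.
move=> gG SG; have [|||||ds [V [[p dsz cnt] [uV sV _]]]] :=
    @grammar_backward_parse_aux T G [::] S S 0 gG _ _ _ isT.
- by rewrite /symbol SG.
- by [].
- by rewrite /substr drop0 take_size.
- by [].
- by [].
exists ds; split=> //; have := uniq_leq_size uV sV.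
by move: cnt => /=; lia.
Qed.

(** The phrase starts form the attractor. A substring containing none of them lies inside a copied
    phrase, and the source gives an occurrence further left, so induction on [i] applies. *)
Lemma backward_parse_attractor (T : eqType) (S : seq T) ds :
    backward_parse S 0 ds -> directives_size ds = size S ->
  exists2 G : {set 'I_(size S)}, attractor G & #|G| <= size ds.
Proof.
move=> bp dsz; pose starts := [seq directives_size (take k ds) | k <- iota 0 (size ds)].
exists [set p : 'I_(size S) | val p \in starts]; last first.
  have -> : size ds = size starts by rewrite size_map size_iota.
  rewrite cardE -(size_map val); apply: uniq_leq_size.
    by rewrite map_inj_uniq ?enum_uniq //; apply: val_inj.
  by move=> _ /mapP[p + ->]; rewrite mem_enum inE.
move=> i l l_gt0; have [N] := ubnP i; elim: N i => // N IH i ltN le_S.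
have [|ds1 [d [ds2 [o [eq_ds lt_o eq_i]]]]] := @directives_locate _ ds i.
  by rewrite dsz; lia.
have d_start : directives_size ds1 \in starts.
  apply/mapP; exists (size ds1); last by rewrite eq_ds take_size_cat.
  by rewrite mem_iota eq_ds size_cat /=; lia.
have ds_split : directives_size ds =
    directives_size ds1 + directive_size d + directives_size ds2.
  by rewrite eq_ds /directives_size map_cat sumn_cat /= addnA.
have [o0|o_gt0] := posnP o.
  have lt_S : i < size S by lia.
  exists i; split=> //; exists (Ordinal lt_S); rewrite ?inE /=; last by lia.
  by move: d_start; rewrite eq_i o0 addn0.
have [lt_l|le_l] := ltnP (directive_size d) (o + l).
  have d2_start : directives_size ds1 + directive_size d \in starts.
    case: ds2 eq_ds ds_split => [|d2 ds2] eq_ds ds_split.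
      by have : directives_size ([::] : seq (directive T)) = 0 by []; lia.
    apply/mapP; exists (size ds1).+1.
      by rewrite mem_iota eq_ds size_cat /=; lia.
    rewrite eq_ds -cat_rcons take_size_cat ?size_rcons //.
    by rewrite /directives_size map_rcons sumn_rcons.
  have lt_S : directives_size ds1 + directive_size d < size S by lia.
  exists i; split=> //; exists (Ordinal lt_S); rewrite ?inE //=; lia.
case: d => [a|src k] in eq_ds lt_o ds_split le_l *; first by move: lt_o => /=; lia.
move: bp; rewrite {1}eq_ds => /backward_parse_mid /= [lt_src le_k eq_src].
move: lt_o le_l => /= lt_o le_l.
have eq_sub : substr S (src + o) l = substr S i l.
  by rewrite eq_i -!(@substr_substr _ _ _ k) ?eq_src.
have [||i' [le_i' eq_i' hit]] := IH (src + o); try lia.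
by exists i'; split=> //; rewrite eq_i' eq_sub.
Qed.

(** Each copy leads strictly to the left, so following copies ends at an explicit symbol. *)
Lemma backward_parse_macro (T : eqType) (S : seq T) ds :
    backward_parse S 0 ds -> directives_size ds = size S -> macro_scheme S ds.
Proof.
move=> bp dsz; split=> // p a; split=> [|Sp].
  elim=> [ds1 b ds2 eq_ds|ds1 src l ds2 o b eq_ds lt_o _ IH];
    move: bp; rewrite eq_ds => /backward_parse_mid //= [_ _ eq_src].
  by rewrite -(@onth_substr _ _ _ l) // -eq_src onth_substr.
have [N] := ubnP p; elim: N p Sp => // N IH p Sp ltN.
have lt_p : p < size S.
  by rewrite ltnNge; apply/negP => le_p; move: Sp; rewrite onthE nth_default ?size_map.
have [|ds1 [[b|src l] [ds2 [o [eq_ds lt_o eq_p]]]]] := @directives_locate _ ds p.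
- by rewrite dsz.
- have {}eq_p : p = directives_size ds1 by move: lt_o eq_p => /=; lia.
  move: bp; rewrite {1}eq_ds => /backward_parse_mid /=.
  by rewrite -eq_p Sp eq_p => -[->]; apply: decodes_explicit eq_ds.
move: bp; rewrite {1}eq_ds => /backward_parse_mid /= [lt_src _ eq_src].
rewrite eq_p; apply: (decodes_copy eq_ds lt_o); apply: IH; last by lia.
by rewrite -(@onth_substr _ _ _ l) // eq_src onth_substr // -eq_p.
Qed.

(** * Greedy LZ77 parsing *)

Lemma longest_phrase (T : eqType) (S : seq T) i : i < size S ->
  exists l, [/\ 0 < l, i + l <= size S, l = 1 \/ occurs_before S i l
    & ~ occurs_before S i l.+1].
Proof.
move=> lt_i; pose P l := (l == 1) || boolp.asbool (occurs_before S i l).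
have P1 : exists l, P l by exists 1.
have leP l : P l -> l <= size S - i by case/orP=> [/eqP|/boolp.asboolP[]]; lia.
case: (ex_maxnP P1 leP) => l Pl max_l; exists l.
have l_gt0 : 0 < l by apply: max_l.
split=> //; first by have := leP _ Pl; lia.
  by case/orP: Pl => [/eqP|/boolp.asboolP]; [left|right].
move=> occ; suff: l.+1 <= l by lia.
by apply: max_l; apply/orP; right; apply/boolp.asboolP.
Qed.

(** Keeping only the lengths makes the parse a recursion along the text; [reshape] recovers the
    phrases. *)
Fixpoint greedy_lengths (T : eqType) (S : seq T) (i : nat) (ls : seq nat) : Prop :=
  if ls is l :: ls' then
    [/\ 0 < l, l = 1 \/ occurs_before S i l, ~ occurs_before S i l.+1
      & greedy_lengths S (i + l) ls']
  else i = size S.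

(* Greedy stays ahead: it never lags behind another parse with the same number
   of phrases. *)
Lemma greedy_lengths_le (T : eqType) (S : seq T) ds i j :
    backward_parse S j ds -> j + directives_size ds = size S -> j <= i <= size S ->
  exists2 ls, greedy_lengths S i ls & size ls <= size ds.
Proof.
elim: ds i j => [|d ds IH] i j.
  rewrite /directives_size /= addn0 => _ -> /andP[le_i ge_i].
  by exists [::] => //=; lia.
rewrite /directives_size /= => -[bd bp] dsz le_ij.
have dsz' : j + directive_size d + directives_size ds = size S.
  by rewrite -dsz addnA.
(* If greedy is already past the phrase [d], that phrase is skipped. *)
have [le_d|lt_d] := leqP (j + directive_size d) i.
  by have [|ls gls le_ls] := IH i _ bp dsz'; [lia | exists ls => //; lia].
have [|l [l_gt0 le_S l_occ l_max]] := @longest_phrase _ S i; first by lia.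
have le_l : j + directive_size d <= i + l.
  case: d bd lt_d {bp dsz dsz'} => [a _ /=|src k /= [lt_src le_k eq_src] lt_d].
    by lia.
  (* Were greedy to stop short of the end of [d], its phrase plus one symbol would lie inside [d]
     and inherit an earlier occurrence from the source of [d]. *)
  rewrite leqNgt; apply/negP => lt_l; apply: l_max.
  by apply: (@occurs_before_sub _ _ j k); [lia | lia | split=> //; exists src].
have [|ls gls le_ls] := IH (i + l) _ bp dsz'; first by lia.
by exists (l :: ls).
Qed.

Lemma greedy_lengths_sumn (T : eqType) (S : seq T) i ls :
  greedy_lengths S i ls -> i + sumn ls = size S.
Proof.
elim: ls i => [|l ls IH] i /=; first by rewrite addn0.
by case=> _ _ _ /IH; rewrite addnA.
Qed.

Lemma greedy_lengths_mid (T : eqType) (S : seq T) i ls1 l ls2 :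
    greedy_lengths S i (ls1 ++ l :: ls2) ->
  [/\ 0 < l, l = 1 \/ occurs_before S (i + sumn ls1) l
    & ~ occurs_before S (i + sumn ls1) l.+1].
Proof.
elim: ls1 i => [|k ls1 IH] i /=; first by rewrite addn0 => -[].
by case=> _ _ _ /IH; rewrite addnA.
Qed.

Lemma greedy_lz77 (T : eqType) (S : seq T) ls :
  greedy_lengths S 0 ls -> lz77_parse S (reshape ls S).
Proof.
move=> gls; have ls_sum : sumn ls = size S := greedy_lengths_sumn gls.
split=> [|ps p qs eq_ls]; first by rewrite reshapeKr // ls_sum.
have: shape (reshape ls S) = ls by rewrite reshapeKl // ls_sum.
rewrite eq_ls /shape map_cat /= => def_ls; move: gls; rewrite -def_ls.
by move/greedy_lengths_mid; rewrite size_flatten.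
Qed.

(** The grammar itself serves as SLP, run-length SLP and collage system. The other three kinds come
    from one backward parse, which costs the extra 1. *)
Lemma grammar_has_size (alpha : repetitiveness) (G : seq (seq bool)) S :
    grammar G -> S \in G ->
  exists2 a, has_size alpha S a & a <= size G + 1.
Proof.
move=> gG SG; have slp := grammar_slp gG SG.
have [ds [bp dsz le_ds]] := grammar_backward_parse gG SG.
case: alpha => /=.
- have [A attA le_A] := backward_parse_attractor bp dsz.
  by exists #|A|; [exists A | apply: leq_trans le_A le_ds].
- by exists (size G); [| apply: leq_addr].
- by exists (size G); [apply: generated_by_sub slp => k [] | apply: leq_addr].
- by exists (size G); [apply: generated_by_sub slp => k [] | apply: leq_addr].
- have [//|ls gls le_ls] := greedy_lengths_le (i := 0) bp dsz.
  exists (size ls); last exact: leq_trans le_ls le_ds.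
  by exists (reshape ls S); [apply: greedy_lz77 | rewrite size_reshape].
- by exists (size ds); [exists ds => //; apply: backward_parse_macro | ].
Qed.

Lemma grammar_measure_value (alpha : repetitiveness) (G : seq (seq bool)) S :
    grammar G -> S \in G ->
  exists2 a, measure_value alpha S a & a <= size G + 1.
Proof.
move=> gG SG; have [a Sa le_a] := grammar_has_size alpha gG SG.
have ex_size : exists a, boolp.asbool (has_size alpha S a).
  by exists a; apply/boolp.asboolP.
case: (ex_minnP ex_size) => b /boolp.asboolP Sb min_b; exists b.
  by split=> // c Sc; apply: min_b; apply/boolp.asboolP.
by apply: leq_trans le_a; apply: min_b; apply/boolp.asboolP.
Qed.

(** * Hard strings *)

Lemma excess_catl u v i : i <= size u -> excess (u ++ v) i = excess u i.
Proof. by move=> le_i; rewrite /excess takel_cat. Qed.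

Lemma excess_catr u v i :
  excess (u ++ v) (size u + i) = (excess u (size u) + excess v i)%R.
Proof.
rewrite /excess take_size take_cat ifF; last by lia.
by rewrite addKn !count_cat; lia.
Qed.

Lemma balancedP S :
  reflect (excess S (size S) = 0%R /\ forall i, i <= size S -> (0 <= excess S i)%R)
          (balanced S).
Proof.
apply: (iffP andP) => [[/eqP-> /allP nonneg]|[-> nonneg]]; split=> //.
  case=> [|i] le_i; first by rewrite /excess take0.
  by apply: nonneg; rewrite mem_iota; lia.
by apply/allP => i; rewrite mem_iota => ?; apply: nonneg; lia.
Qed.

Lemma balanced_cat u v : balanced u -> balanced v -> balanced (u ++ v).
Proof.
move=> /balancedP[u0 u_ge] /balancedP[v0 v_ge]; apply/balancedP.
rewrite size_cat excess_catr u0 v0; split=> // i le_i.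
have [le_u|lt_u] := leqP i (size u); first by rewrite excess_catl ?u_ge.
rewrite (_ : i = size u + (i - size u)); last by lia.
by rewrite excess_catr u0 add0r v_ge; lia.
Qed.

Lemma balanced_flatten us : all balanced us -> balanced (flatten us).
Proof. by elim: us => //= u us IH /andP[bu /IH]; apply: balanced_cat. Qed.

(** * Blocks encoding one bit *)

Definition gadget (b : bool) : seq bool :=
  if b then [:: true; true; false; false] else [:: true; false; true; false].

Lemma balanced_gadget b : balanced (gadget b). Proof. by case: b. Qed.

(** The query depends on the length [p] of the preceding text but not on the bit. After a balanced
    text the excess inside the block is 1, 2, 1, 0 or 1, 0, 1, 0. *)
Definition gadget_query (op : operation) (p : nat) : query op :=
  match op return query op with
  | Excess => p + 2
  | FindClose => p + 1
  | FindOpen => p + 4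
  | FwdSearch => (p + 1, (-1)%R)
  | BwdSearch => (p + 3, (-1)%R)
  | RangeMin | RangeMax => (p + 2, p + 2)
  | RangeMinPos | RangeMaxPos => (p + 1, p + 3)
  end.

Definition gadget_answer (op : operation) (p : nat) (b : bool) : answer op :=
  match op return answer op with
  | Excess | RangeMin | RangeMax => if b then 2%R else 0%R
  | FindClose | FwdSearch => p + (if b then 4 else 2)
  | FindOpen => p + (if b then 1 else 3)
  | BwdSearch => p + (if b then 0 else 2)
  | RangeMinPos => p + (if b then 1 else 2)
  | RangeMaxPos => p + (if b then 2 else 1)
  end.

Lemma gadget_answer_inj op p : injective (gadget_answer op p).
Proof. by case: op => -[] [] //= /addnI. Qed.

(** For the bit [true] the backward search answers with position [p] itself, so [u] has to be
    nonempty. *)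
Lemma gadget_op_spec op u b v : 0 < size u -> balanced u ->
  op_spec (u ++ gadget b ++ v) (gadget_query op (size u))
          (gadget_answer op (size u) b).
Proof.
move=> u_gt0 /balancedP[u0 _]; set S := u ++ _; set p := size u in u_gt0 *.
have E j : excess S (p + j) = excess (gadget b ++ v) j.
  by rewrite excess_catr u0 add0r.
have E0 : excess S p = 0%R by rewrite /S excess_catl.
have E1 : excess S (p + 1) = 1%R by rewrite E excess_catl; case: (b).
have E2 : excess S (p + 2) = if b then 2%R else 0%R by rewrite E excess_catl; case: (b).
have E3 : excess S (p + 3) = 1%R by rewrite E excess_catl; case: (b).
have E4 : excess S (p + 4) = 0%R by rewrite E excess_catl; case: (b).
have szS : p + 4 <= size S by rewrite !size_cat; case: (b) => /=; lia.
have matchS i j : i < j < 4 -> nth false (gadget b) i ->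
    nth true (gadget b) j = false ->
    balanced (take (j - i).-1 (drop i.+1 (gadget b))) ->
  matching S (p + i.+1) (p + j.+1).
  have szb : size (gadget b) = 4 by case: (b).
  have Snth x l : l < 4 -> nth x S (p + l) = nth x (gadget b) l.
    move=> lt_l; rewrite nth_cat ifF ?addKn; last by rewrite -/p; lia.
    by rewrite nth_cat szb lt_l.
  move=> lt_ij open_i close_j bal; split; rewrite ?addnS /= ?Snth //; try lia.
  have -> : (p + j - (p + i)).-1 = (j - i).-1 by lia.
  rewrite -addnS addnC -drop_drop drop_size_cat // drop_cat szb ifT; last by lia.
  by rewrite takel_cat // size_drop szb; lia.
have range13 (P : nat -> Prop) : P (p + 1) -> P (p + 2) -> P (p + 3) ->
    forall k, p + 1 <= k <= p + 3 -> P k.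
  move=> P1 P2 P3 k le_k.
  by have [->|[->|->]] : k = p + 1 \/ k = p + 2 \/ k = p + 3 by lia.
have range2 k : p + 2 <= k <= p + 2 -> k = p + 2 by lia.
have range1 k : p + 1 <= k < p + 2 -> k = p + 1 by lia.
(* From here on only the recorded excess values and matchings of [S] matter. *)
move: E1 E2 E3 E4 matchS; clearbody S; clear E.
case: b => E1 E2 E3 E4 matchS; case: op => /=; rewrite ?E2 ?addn0.
- by split=> //; lia.
- exact: (matchS 0 3).
- exact: (matchS 0 3).
- split; rewrite ?E1 ?E4 //; try lia.
  move=> k lt_k; have {lt_k} : p + 1 <= k <= p + 3 by lia.
  by move: k; apply: range13; rewrite ?E1 ?E2 ?E3.
- split; rewrite ?E3 ?E0 //; try lia.
  move=> k lt_k; have {lt_k} : p + 1 <= k <= p + 3 by lia.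
  by move: k; apply: range13; rewrite ?E1 ?E2 ?E3.
- by split; [lia | exists (p + 2); rewrite ?leqnn ?E2 | move=> k /range2->; rewrite E2].
- by split; [lia | exists (p + 2); rewrite ?leqnn ?E2 | move=> k /range2->; rewrite E2].
- split; try lia.
  by apply: range13; rewrite ?E1 ?E2 ?E3.
- split; try lia; first by apply: range13; rewrite ?E1 ?E2 ?E3.
  by move=> k /range1->; rewrite E1.
- by split=> //; lia.
- exact: (matchS 0 1).
- exact: (matchS 2 3).
- by split; rewrite ?E1 ?E2 //; lia.
- by split; rewrite ?E3 ?E2 //; lia.
- by split; [lia | exists (p + 2); rewrite ?leqnn ?E2 | move=> k /range2->; rewrite E2].
- by split; [lia | exists (p + 2); rewrite ?leqnn ?E2 | move=> k /range2->; rewrite E2].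
- split; try lia; first by apply: range13; rewrite ?E1 ?E2 ?E3.
  by move=> k /range1->; rewrite E1.
- split; try lia.
  by apply: range13; rewrite ?E1 ?E2 ?E3.
Qed.

(** * Nested exclusive-or strings *)

Fixpoint nested m (f : nat -> nat -> bool) i (b : bool) : seq bool :=
  if i is i'.+1 then flatten [seq nested m f i' (b (+) f i' y) | y <- iota 0 m]
  else gadget b.

Fixpoint offset m (y : nat -> nat) i : nat :=
  if i is i'.+1 then y i' * m ^ i' + offset m y i' else 0.

Lemma balanced_nested m f i b : balanced (nested m f i b).
Proof.
elim: i b => [|i IH] b /=; first exact: balanced_gadget.
by apply: balanced_flatten; apply/allP => _ /mapP[y _ ->].
Qed.

Lemma size_flatten_const (T U : Type) (g : U -> seq T) s l :
  (forall x, size (g x) = l) -> size (flatten (map g s)) = size s * l.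
Proof. by move=> szg; elim: s => //= x s IH; rewrite size_cat szg IH mulSn. Qed.

Lemma size_nested m f i b : size (nested m f i b) = 4 * m ^ i.
Proof.
elim: i b => [|i IH] b /=; first by case: b.
rewrite (size_flatten_const _ (l := 4 * m ^ i)); last by move=> y; apply: IH.
by rewrite size_iota expnS mulnCA.
Qed.

(** At each level, [y i] sibling strings of equal length precede the chosen one, and the choice adds
    [f i (y i)] to the parity accumulated so far. *)
Lemma nested_locate m f y i b : (forall j, j < i -> y j < m) ->
  exists u v, [/\ balanced u, balanced v, size u = 4 * offset m y i
    & nested m f i b = u ++ gadget (b (+) odd (\sum_(j < i) f j (y j))) ++ v].
Proof.
elim: i b => [|i IH] b lt_y.
  by exists [::], [::]; rewrite big_ord0 addbF cats0.
have [|u [v [bu bv szu eq_uv]]] := IH (b (+) f i (y i)).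
  by move=> j lt_j; apply: lt_y; apply: ltnW.
have lt_yi := lt_y i (ltnSn i).
pose g z := nested m f i (b (+) f i z).
exists (flatten [seq g z | z <- iota 0 (y i)] ++ u).
exists (v ++ flatten [seq g z | z <- iota (y i).+1 (m - (y i).+1)]).
have bg s : balanced (flatten [seq g z | z <- s]).
  by apply: balanced_flatten; apply/allP => _ /mapP[z _ ->]; apply: balanced_nested.
split; try exact: balanced_cat.
  rewrite size_cat szu (size_flatten_const _ (l := 4 * m ^ i)); last first.
    by move=> z; apply: size_nested.
  by rewrite size_iota /= mulnDr mulnCA.
have -> : nested m f i.+1 b = flatten [seq g z | z <- iota 0 m] by [].
have -> : iota 0 m = iota 0 (y i) ++ y i :: iota (y i).+1 (m - (y i).+1).
  by rewrite -[in LHS](subnKC lt_yi) addSnnS iotaD.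
rewrite map_cat flatten_cat /= {2}/g eq_uv -!catA; congr (_ ++ (_ ++ (gadget _ ++ _))).
by rewrite big_ord_recr /= oddD oddb -addbA [f i _ (+) _]addbC.
Qed.

Definition gadget_grammar : seq (seq bool) :=
  [:: gadget true; gadget false; [:: true; true; false]; [:: true; false]].

Lemma grammar_gadget : grammar gadget_grammar.
Proof.
move=> w; rewrite !inE => /or4P[] /eqP->; by [exists 3|exists 2|exists 1|exists 1].
Qed.

(** Only the accumulated parity is passed down, so a level has just two distinct strings, each a
    concatenation of [m] strings of the level below. *)
Lemma grammar_nested m f i : 0 < m ->
  exists G, [/\ grammar G, {subset gadget_grammar <= G},
    forall b, symbol G (nested m f i b) & size G <= 4 + i * (2 * m)].
Proof.
move=> m_gt0; elim: i => [|i [G [gG sub sG szG]]].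
  by exists gadget_grammar; split=> //; [exact: grammar_gadget | case].
have pieces b : all (symbol G) [seq nested m f i (b (+) f i y) | y <- iota 0 m].
  by apply/allP => _ /mapP[y _ ->].
have sz b : size [seq nested m f i (b (+) f i y) | y <- iota 0 m] = m.
  by rewrite size_map size_iota.
have [|G1 [gG1 sub1 s1 sz1]] := grammar_flatten gG (pieces false); first by rewrite sz.
have pieces1 : all (symbol G1) [seq nested m f i (true (+) f i y) | y <- iota 0 m].
  by apply: sub_all (pieces true) => w; apply: sub_symbol.
have [|G2 [gG2 sub2 s2 sz2]] := grammar_flatten gG1 pieces1; first by rewrite sz.
exists G2; split=> //.
- by move=> w /sub /sub1 /sub2.
- by case=> //=; apply: sub_symbol s1.
- by move: sz1 sz2; rewrite !sz mulSn; lia.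
Qed.

(* The leading pair is needed by the backward search, whose answer may be the
   position just before a gadget. *)
Definition hard_string m f i k : seq bool :=
  [:: true; false] ++ nested m f i false ++ flatten (nseq k [:: true; false]).

Lemma size_hard_string m f i k : size (hard_string m f i k) = 4 * m ^ i + 2 * k.+1.
Proof.
rewrite /hard_string !size_cat size_nested size_flatten /shape map_nseq sumn_nseq.
by rewrite /=; lia.
Qed.

Lemma hard_string_locate m f y i k : (forall j, j < i -> y j < m) ->
  exists u v, [/\ balanced u, balanced v, size u = (4 * offset m y i).+2
    & hard_string m f i k = u ++ gadget (odd (\sum_(j < i) f j (y j))) ++ v].
Proof.
move=> lt_y; have [u [v [bu bv szu eq_uv]]] := nested_locate f false lt_y.
exists ([:: true; false] ++ u), (v ++ flatten (nseq k [:: true; false])).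
split; first exact: balanced_cat.
- by apply: balanced_cat => //; apply: balanced_flatten; apply/allP => w /nseqP[->].
- by rewrite /= szu.
- by rewrite /hard_string eq_uv -!catA.
Qed.

Lemma balanced_hard_string m f i k : balanced (hard_string m f i k).
Proof.
apply: balanced_cat => //; apply: balanced_cat; first exact: balanced_nested.
by apply: balanced_flatten; apply/allP => w /nseqP[->].
Qed.

(** The padding costs [2 * l] by repeated doubling. The 7 consists of 4 strings for the gadgets, 2
    final concatenations and 1 for the passage to [alpha]. *)
Lemma hard_string_measure alpha m f i k l : 0 < m -> 0 < k < 2 ^ l ->
  exists2 a, measure_value alpha (hard_string m f i k) a
    & a <= i * (2 * m) + 2 * l + 7.
Proof.
move=> m_gt0 lt_k; have [G [gG sub sG szG]] := grammar_nested f i m_gt0.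
have pair_symbol : symbol G [:: true; false].
  by apply/orP; left; apply: sub; rewrite !inE eqxx !orbT.
have [G1 [gG1 sub1 s1 sz1]] := grammar_repeat gG pair_symbol lt_k.
have gG2 := grammar_cons gG1 (sub_symbol sub1 (sG false)) s1.
set w := _ ++ _ in gG2.
have sub2 : {subset G1 <= w :: G1} by move=> x; rewrite inE orbC => ->.
have gG3 : grammar (hard_string m f i k :: w :: G1).
  apply: grammar_cons gG2 _ _; last by rewrite /symbol inE eqxx.
  by apply: sub_symbol pair_symbol => x /sub1 /sub2.
have [|a Sa le_a] := grammar_measure_value alpha gG3 (S := hard_string m f i k).
  by rewrite inE eqxx.
by exists a => //; move: le_a sz1 szG => /=; lia.
Qed.

(** * Counting in the cell-probe model *)

Fixpoint trace (W A : Type) (mem : nat -> W) (t : probe_tree W A) : seq nat :=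
  match t with
  | Return _ => [::]
  | Probe addr next => addr :: trace mem (next (mem addr))
  end.

Lemma size_trace (W A : Type) (mem : nat -> W) (t : probe_tree W A) :
  size (trace mem t) = probes mem t.
Proof. by elim: t => //= addr next IH; rewrite IH. Qed.

Lemma run_agree (W A : Type) (mem mem' : nat -> W) (t : probe_tree W A) :
  {in trace mem t, mem =1 mem'} -> run mem t = run mem' t.
Proof.
elim: t => //= addr next IH agree.
rewrite -(agree addr) ?inE ?eqxx //; apply: IH => a ta.
by apply: agree; rewrite inE ta orbT.
Qed.

Lemma pigeonhole_card (X Y : finType) (h : X -> Y) N :
  #|Y| * N < #|X| -> exists c, N < #|[set x | h x == c]|.
Proof.
move=> lt_X; apply/existsP; apply: contraLR lt_X; rewrite negb_exists -leqNgt.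
move/forallP=> le_N; rewrite -sum1_card (partition_big h predT) //=.
apply: leq_trans (_ : \sum_(c : Y) N <= _); last by rewrite sum_nat_const.
apply: leq_sum => c _; have := le_N c; rewrite -leqNgt; apply: leq_trans.
by rewrite sum1dep_card.
Qed.

(** Otherwise [Q] would lie in a product of [C] sets with at most [k] elements each. *)
Lemma wide_coordinate C m k (Q : {set {ffun 'I_C -> 'I_m}}) :
  k ^ C < #|Q| -> exists i, k < #|[set y i | y : {ffun 'I_C -> 'I_m} in Q]|.
Proof.
move=> lt_Q; apply/existsP; apply: contraLR lt_Q; rewrite negb_exists -leqNgt.
move/forallP=> le_k; pose F i := [set y i | y : {ffun 'I_C -> 'I_m} in Q].
apply: (@leq_trans #|family F|).
  apply/subset_leq_card/subsetP => y yQ; apply/familyP => i.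
  exact: imset_f.
rewrite card_family /image_mem foldrE big_map big_enum /=.
apply: leq_trans (_ : \prod_(i < C) k <= _); last by rewrite prod_nat_const card_ord.
by apply: leq_prod => i _; rewrite leqNgt; apply: le_k.
Qed.

Definition parity C m (f : {set 'I_C * 'I_m}) (y : {ffun 'I_C -> 'I_m}) : bool :=
  odd (\sum_(i < C) ((i, y i) \in f)).

(** For [y] in [Q] only the pair [(i, y i)] lies in [D]. The other terms of the parity agree for [f]
    and [g], so equal parities give equal bits at that pair. *)
Lemma parity_determines C m (f g : {set 'I_C * 'I_m})
    (Q : {set {ffun 'I_C -> 'I_m}}) i :
    let D := [set (i, y i) | y : {ffun 'I_C -> 'I_m} in Q] in
  {in Q, parity f =1 parity g} -> f :\: D = g :\: D -> f = g.
Proof.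
move=> D fgQ fgD.
have outD x : x \notin D -> (x \in f) = (x \in g).
  by move=> xD; have := congr1 (fun A : {set _} => x \in A) fgD; rewrite !inE xD.
apply/setP => x; have [/imsetP[y yQ ->]|] := boolP (x \in D); last exact: outD.
have := fgQ y yQ; rewrite /parity (bigD1 i) //= [in RHS](bigD1 i) //=.
rewrite !oddD !oddb => /eqP.
have -> : \sum_(j < C | j != i) ((j, y j) \in f : nat) =
          \sum_(j < C | j != i) ((j, y j) \in g : nat).
  apply: eq_bigr => j ne_j; rewrite outD //; apply/imsetP => -[z _ [eq_j _]].
  by rewrite eq_j eqxx in ne_j.
by rewrite (inj_eq (@addIb _)) => /eqP.
Qed.

(* With at most [s] cells and [t] probes there are only [s.+1 ^ t] sequences of
   addresses (all addresses from [s] on read the same), so for each [f] one of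
   them serves many queries; the contents of these few cells determine the
   answers to all these queries, hence too many bits of [f]. *)
Lemma cell_probe_counting C m k s t (W : finType) (A : Type) (w0 : W)
    (mem : {set 'I_C * 'I_m} -> nat -> W)
    (alg : {ffun 'I_C -> 'I_m} -> probe_tree W A) :
    0 < C -> s.+1 ^ t * k ^ C < m ^ C -> (s.+1 * #|W|) ^ t < 2 ^ k ->
    (forall f a, s <= a -> mem f a = w0) ->
    (forall f y, probes (mem f) (alg y) <= t) ->
  ~ (forall f g y, run (mem f) (alg y) = run (mem g) (alg y) ->
       parity f y = parity g y).
Proof.
move=> C_gt0 many few mem_s le_t decode.
(* Addresses from [s] on are merged into [s], which also pads the traces shorter than [t]. *)
pose key f y : {ffun 'I_t -> 'I_s.+1} :=
  [ffun j : 'I_t => inord (minn s (nth s (trace (mem f) (alg y)) j))].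
have popular f : exists r, k ^ C < #|[set y | key f y == r]|.
  by apply: pigeonhole_card; rewrite !card_ffun !card_ord.
pose r f := xchoose (popular f).
pose code f : {ffun 'I_t -> 'I_s.+1} * {ffun 'I_t -> W} :=
  (r f, [ffun j => mem f (r f j)]).
have lt_km : k < m.
  rewrite -(ltn_exp2r _ _ C_gt0); apply: leq_ltn_trans many.
  by rewrite leq_pmull // expn_gt0.
have le_kCm : k <= C * m by apply: leq_trans (ltnW lt_km) _; rewrite leq_pmull.
(* There are [2 ^ (C * m)] tables and fewer than [2 ^ k] codes. *)
have [|c] := @pigeonhole_card _ _ code (2 ^ (C * m - k)).
  rewrite -[X in _ < X]cardsT -powersetT card_powerset cardsT.
  rewrite !card_prod !card_ffun !card_ord -expnMn.
  rewrite -[X in _ < 2 ^ X](subnKC le_kCm) expnD ltn_pmul2r //.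
  by rewrite expn_gt0.
set F := [set f | _] => big_F.
have /set0Pn[f0 f0F] : F != set0 by rewrite -card_gt0; apply: leq_trans big_F.
pose Q := [set y | key f0 y == r f0].
(* On [f0], a query of [Q] probes only cells listed in [r f0] or beyond the memory, and there all
   tables of [F] have the same contents. *)
have agree f y : f \in F -> y \in Q -> run (mem f0) (alg y) = run (mem f) (alg y).
  move: f0F; rewrite !inE => /eqP <- /eqP[eq_r eq_mem] /eqP eq_key.
  apply: run_agree => a /(nthP s)[j]; rewrite size_trace => lt_j eq_a.
  have lt_jt := leq_trans lt_j (le_t f0 y).
  have := congr1 (fun g : {ffun _ -> _} => val (g (Ordinal lt_jt))) eq_key.
  rewrite ffunE /= inordK ?ltnS ?geq_minl // eq_a => eq_min.
  have [le_s|lt_s] := leqP s a; first by rewrite !mem_s.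
  have := congr1 (fun g : {ffun _ -> _} => g (Ordinal lt_jt)) eq_mem.
  by rewrite !ffunE eq_r -eq_min (minn_idPr (ltnW lt_s)).
have [i wide] := wide_coordinate (xchooseP (popular f0) : k ^ C < #|Q|).
pose D := [set (i, y i) | y : {ffun 'I_C -> 'I_m} in Q].
have cardD : k < #|D|.
  apply: leq_trans wide _; apply: leq_trans (leq_imset_card snd D).
  apply/subset_leq_card/subsetP => _ /imsetP[y yQ ->].
  by apply/imsetP; exists (i, y i) => //; apply: imset_f.
have inj : {in F &, injective (fun f => f :\: D)}.
  move=> f g fF gF; apply: parity_determines => y yQ; apply: decode.
  by rewrite -!agree.
(* Tables of [F] are told apart by their bits outside [D], of which there are fewer than
   [C * m - k]. *)
have : #|F| <= 2 ^ (C * m - k).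
  rewrite -(card_in_imset inj); apply: (@leq_trans #|powerset (~: D)|).
    by apply/subset_leq_card/subsetP => _ /imsetP[f _ ->]; rewrite inE setDE subsetIr.
  rewrite card_powerset leq_exp2l // cardsCs setCK card_prod !card_ord; lia.
by rewrite leqNgt big_F.
Qed.

(** * Choice of parameters *)

(** The type of a cell depends on the length of the string; the cast gives all strings of length [n]
    memories of one type. *)
Definition cell_at Q A (D : static_ds Q A) n S (e : size S = n) :
    nat -> (word_size D n).-tuple bool :=
  ecast n (nat -> (word_size D n).-tuple bool) e (cell D S).

Lemma cell_atP Q A (D : static_ds Q A) n S (e : size S = n) :
  [/\ forall q, run (cell_at D e) (query_alg D n q) = ds_answer D S q,
      forall q, probes (cell_at D e) (query_alg D n q) = query_time D S q
    & forall a, size (memory D S) <= a ->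
        cell_at D e a = [tuple of nseq (word_size D n) false]].
Proof.
case: n / e; split=> // a le_a.
by rewrite /cell_at /= /cell nth_default.
Qed.

Definition bit_table C m (f : {set 'I_C * 'I_m}) (i y : nat) : bool :=
  [exists x in f, (val x.1 == i) && (val x.2 == y)].

Lemma bit_tableE C m (f : {set 'I_C * 'I_m}) (i : 'I_C) (y : 'I_m) :
  bit_table f i y = ((i, y) \in f).
Proof.
apply/existsP/idP => [[[i' y'] /and3P[/= xf /eqP/val_inj<- /eqP/val_inj<-]]|xf] //.
by exists (i, y); rewrite xf /= !eqxx.
Qed.

Definition digits C m (y : {ffun 'I_C -> 'I_m}) (j : nat) : nat :=
  if insub j is Some i then val (y i) else 0.

Lemma digitsE C m (y : {ffun 'I_C -> 'I_m}) (i : 'I_C) : digits y i = y i.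
Proof. by rewrite /digits valK. Qed.

(** If all these queries made at most [t] probes, the counting bound would be violated: equal runs
    give equal answers, and an answer at a known position determines the bit. *)
Lemma hard_query op (D : static_ds (query op) (answer op)) n C m k s t p :
    supports D -> 0 < C -> 4 * m ^ C + 2 * p.+1 = n ->
    (forall f, size (memory D (hard_string m f C p)) <= s) ->
    s.+1 ^ t * k ^ C < m ^ C -> (s.+1 * 2 ^ word_size D n) ^ t < 2 ^ k ->
  exists S q a, [/\ balanced S, size S = n, op_spec S q a & t < query_time D S q].
Proof.
move=> supD C_gt0 def_n le_s many few.
pose S (f : {set 'I_C * 'I_m}) := hard_string m (bit_table f) C p.
have szS f : size (S f) = n by rewrite size_hard_string.
pose pos (y : {ffun 'I_C -> 'I_m}) := (4 * offset m (digits y) C).+2.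
have spec f y :
  op_spec (S f) (gadget_query op (pos y)) (gadget_answer op (pos y) (parity f y)).
  have [|u [v [bu _ szu eq_S]]] := @hard_string_locate m (bit_table f) (digits y) C p.
    by move=> j lt_j; rewrite (digitsE y (Ordinal lt_j)).
  rewrite /S eq_S /pos -szu.
  have -> : parity f y = odd (\sum_(j < C) bit_table f j (digits y j)).
    by congr odd; apply: eq_bigr => j _; rewrite digitsE bit_tableE.
  by apply: gadget_op_spec; rewrite ?szu.
have [/existsP[f /existsP[y lt_t]]|fast] :=
    boolP [exists f, exists y, t < query_time D (S f) (gadget_query op (pos y))].
  exists (S f), (gadget_query op (pos y)), (gadget_answer op (pos y) (parity f y)).
  by split=> //; apply: balanced_hard_string.
case: (@cell_probe_counting C m k s t _ (answer op)
  [tuple of nseq (word_size D n) false] (fun f => cell_at D (szS f))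
  (fun y => query_alg D n (gadget_query op (pos y)))) => //.
- by rewrite card_tuple card_bool.
- move=> f a le_a; have [_ _ zero] := cell_atP D (szS f).
  exact: zero (leq_trans (le_s _) le_a).
- move=> f y; have [_ -> _] := cell_atP D (szS f); rewrite leqNgt.
  by move: fast; rewrite negb_exists => /forallP/(_ f); rewrite negb_exists => /forallP.
move=> f g y; have [-> _ _] := cell_atP D (szS f); have [-> _ _] := cell_atP D (szS g).
rewrite !(supD _ _ _ (balanced_hard_string _ _ _ _) (spec _ y)).
exact: gadget_answer_inj.
Qed.

Lemma linear_lt_exp b : 7 <= b -> 5 * b + 3 <= 2 ^ b.-1.
Proof.
elim: b => // b IH; rewrite leq_eqVlt => /predU1P[<-|b_ge]; first by vm_compute.
have -> : b.+1.-1 = b.-1.+1 by lia.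
by rewrite expnS; have := IH b_ge; lia.
Qed.

(** The blocks take up at most half of [n], which leaves room for at least one pair of padding. *)
Lemma half_padding n l M :
    2 ^ l <= n < 2 ^ l.+1 -> ~~ odd n -> 0 < M -> 8 * M <= 2 ^ l ->
  exists2 p, 4 * M + 2 * p.+1 = n & 0 < p < 2 ^ l.
Proof.
rewrite expnS; move: (2 ^ l) => N n_bounds even_n M_gt0 le_M.
by exists (n./2 - 2 * M - 1); lia.
Qed.

Lemma grammar_size_bound B C l a : 64 <= B -> C <= l -> l < B ->
  a <= C * (2 * B ^ 5) + 2 * l + 7 -> a <= B ^ 7.
Proof.
move=> B_ge le_C lt_l le_a; have : 64 * (B * B ^ 5) <= B ^ 7.
  by rewrite -(expnS B 5) (expnS B 6) leq_mul2r B_ge orbT.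
have : C * B ^ 5 <= B * B ^ 5 by rewrite leq_mul2r (leq_trans le_C (ltnW lt_l)) orbT.
have : B * 1 <= B * B ^ 5 by rewrite leq_mul2l expn_gt0 (leq_trans _ B_ge) ?orbT.
move: le_a; rewrite mulnCA muln1; move: (C * _) (B * _) (B ^ 7); lia.
Qed.

(** The left side bounds the bits of a code: [b * C] for the addresses, the rest for at most [B]
    cells of at most [K * B] bits. *)
Lemma code_length_bound B K C b : K.+2 <= B -> b * C < B ->
  b * C + K * B * B < B ^ 3.
Proof.
move=> le_K lt_bC; have le_K3 : K.+2 * (B * B) <= B ^ 3.
  by rewrite !expnS expn0 muln1 leq_mul2r le_K orbT.
have le_B2 : B <= B * B by rewrite leq_pmulr // (leq_trans _ lt_bC).
by apply: leq_trans le_K3; rewrite -mulnA !mulSn; lia.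
Qed.

(* [B] is log n rounded up to a power of 2, so the memory has less than
   B^(c + 8) cells.  With m = B^5 and t = C / (c + 8) there are at most B^C
   address sequences, so some coordinate takes more than B^3 values, while t
   cells hold only O(B^2) bits. *)
Lemma hard_query_asymptotic alpha op (D : static_ds (query op) (answer op))
    Kw Ks c n1 : supports D ->
    (forall n, n1 <= n -> word_size D n <= Kw * (trunc_log 2 n).+1) ->
    (forall S a, balanced S -> n1 <= size S -> measure_value alpha S a ->
      size (memory D S) <= Ks * a * (trunc_log 2 (size S)).+1 ^ c) ->
  exists n0, forall n, n0 <= n -> ~~ odd n ->
    exists S q a, [/\ balanced S, size S = n, op_spec S q a
      & (trunc_log 2 n).+1 <=
        8 * (trunc_log 2 (trunc_log 2 n)).+1 * (c + 8) * query_time D S q].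
Proof.
(* The threshold makes log n, and with it [B], exceed both constants [Ks] and [Kw]. *)
move=> supD le_word le_space; exists (n1 + 2 ^ (64 + Ks + Kw)) => n le_n even_n.
have n1_n : n1 <= n := leq_trans (leq_addr _ _) le_n.
have pow_n : 2 ^ (64 + Ks + Kw) <= n := leq_trans (leq_addl _ _) le_n.
have n_gt0 : 0 < n by apply: leq_trans pow_n; rewrite expn_gt0.
set lam := trunc_log 2 n; set beta := (trunc_log 2 lam).+1.
have lam_ge : 64 + Ks + Kw <= lam by apply: trunc_log_max.
have lam_n : 2 ^ lam <= n < 2 ^ lam.+1 by apply: trunc_log_bounds.
clearbody lam; clear pow_n le_n.
have /andP[beta_lam lam_beta] : 2 ^ beta.-1 <= lam < 2 ^ beta.
  by apply: trunc_log_bounds => //; lia.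
have beta_ge : 7 <= beta by rewrite ltnS; apply: (@trunc_log_max 2 lam 6); lia.
have beta_gt0 : 0 < beta by [].
(* This gives [5 * beta + 3 <= lam], so that at least one digit fits. *)
clearbody beta; have big_lam := leq_trans (linear_lt_exp beta_ge) beta_lam.
clear beta_lam.
(* Since [m] is [2 ^ (5 * beta)], this [C] is the largest with [8 * m ^ C <= 2 ^ lam], as the
   padding requires. *)
set B := 2 ^ beta in lam_beta; pose m := B ^ 5; pose C := (lam - 3) %/ (5 * beta).
have [B_ge Ks_B Kw_B] : [/\ 64 <= B, Ks.+1 <= B & Kw.+2 <= B].
  by move: lam_ge lam_beta; clear; move: B; split; lia.
have B_gt1 : 1 < B by apply: leq_trans B_ge.
have B_gt0 : 0 < B := ltnW B_gt1.
have beta5_gt0 : 0 < 5 * beta by rewrite muln_gt0.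
have le_C : C * (5 * beta) <= lam - 3 by apply: leq_trunc_div.
have lt_C : lam - 3 < C.+1 * (5 * beta) by apply: ltn_ceil.
have C_gt0 : 0 < C by rewrite divn_gt0 // -(leq_add2r 3) subnK //; lia.
have le_C_lam : C <= lam := leq_trans (leq_div _ _) (leq_subr _ _).
have le_C_B : C <= B := leq_trans le_C_lam (ltnW lam_beta).
clearbody C.
have mC : m ^ C = 2 ^ (C * (5 * beta)).
  by rewrite /m /B -!expnM mulnA [beta * _]mulnC [C * _]mulnC.
have mC_n : 8 * m ^ C <= 2 ^ lam.
  rewrite mC -[8]/(2 ^ 3) -expnD leq_exp2l //.
  by move: le_C big_lam; clear; lia.
have [|p def_n lt_p] := half_padding lam_n even_n _ mC_n; first by rewrite mC expn_gt0.
have m_gt0 : 0 < m by rewrite expn_gt0 B_gt0.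
pose s := Ks * B ^ (c + 7).
have le_s f : size (memory D (hard_string m f C p)) <= s.
  have [a Sa le_a] := hard_string_measure alpha f C m_gt0 lt_p.
  apply: leq_trans (le_space _ _ _ _ Sa) _; rewrite ?size_hard_string ?def_n //.
    exact: balanced_hard_string.
  rewrite /s -mulnA leq_mul2l expnD [B ^ c * _]mulnC leq_mul ?orbT //.
    exact: grammar_size_bound le_a.
  have -> : trunc_log 2 n = lam by apply: trunc_log_eq.
  by case: (c) => // c'; rewrite leq_exp2r.
pose t := C %/ (c + 8).
have le_sB : s.+1 <= B ^ (c + 8).
  rewrite addnS expnS; apply: (@leq_trans (Ks.+1 * B ^ (c + 7))).
    by rewrite mulSn -add1n leq_add2r expn_gt0 B_gt0.
  by rewrite leq_mul2r Ks_B orbT.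
have le_t : t * (c + 8) <= C by apply: leq_trunc_div.
have le_st : s.+1 ^ t <= B ^ C.
  apply: (@leq_trans ((B ^ (c + 8)) ^ t)).
    by case: (t) => // t'; rewrite leq_exp2r.
  by rewrite -expnM leq_exp2l // mulnC.
have [||S [q [a [bS szS spec lt_t]]]] :=
    @hard_query op D n C m (B ^ 3) s t p supD C_gt0 def_n le_s.
- apply: (@leq_ltn_trans (B ^ C * (B ^ 3) ^ C)); first by rewrite leq_mul2r le_st orbT.
  by rewrite /m -expnMn -expnS ltn_exp2r // ltn_exp2l.
- rewrite expnMn -expnM; apply: (@leq_ltn_trans (B ^ C * 2 ^ (Kw * B * B))).
    apply: leq_mul => //; rewrite leq_exp2l //; apply: leq_mul; last first.
      exact: leq_trans (leq_div _ _) le_C_B.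
    apply: leq_trans (le_word n n1_n) _; rewrite leq_mul2l.
    by rewrite (trunc_log_eq _ lam_n) // lam_beta orbT.
  rewrite {1}/B -expnM -expnD ltn_exp2l //; apply: code_length_bound => //.
  apply: leq_ltn_trans lam_beta; apply: leq_trans (leq_subr 3 lam).
  by apply: leq_trans le_C; rewrite mulnC leq_mul2l leq_pmull ?orbT.
exists S, q, a; split=> //; rewrite -?mulnA.
have C_lt : C < t.+1 * (c + 8) by apply: ltn_ceil; rewrite addnS.
set tau := query_time D S q in lt_t *.
have le_tau : t.+1 * (c + 8) <= (c + 8) * tau by rewrite mulnC leq_mul2l lt_t orbT.
(* Rounding in [C] and [t] leaves [lam.+1 <= 5 * Z + 3], which is at most [8 * Z] as [Z] is
   positive. *)
pose Z := beta * ((c + 8) * tau).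
have Z_gt0 : 0 < Z by rewrite !muln_gt0 beta_gt0 addnS (leq_trans _ lt_t).
have le_Z : C.+1 * (5 * beta) <= 5 * Z.
  by rewrite /Z mulnCA !leq_mul2l mulnC leq_mul2l (leq_trans C_lt le_tau) !orbT.
by move: (leq_trans lt_C le_Z) Z_gt0; rewrite -/Z; clear; lia.
Qed.

(** * From binary to natural logarithms *)

Local Open Scope ring_scope.

Lemma ln2_ge_half (R : realType) : 1 / 2 <= ln (2 : R).
Proof.
have := @le_ln1Dx R (- (1 / 2)); have -> : 1 + - (1 / 2) = 2^-1 :> R by lra.
by rewrite lnV ?posrE //; lra.
Qed.

Lemma ln_exp2_ge (R : realType) k (x : R) : 2 ^+ k <= x -> k%:R / 2 <= ln x.
Proof.
move=> le_x; have := ln2_ge_half R => ln2.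
have le_ln : ln (2 ^+ k) <= ln x.
  by rewrite ler_ln ?posrE ?exprn_gt0 // (lt_le_trans _ le_x) ?exprn_gt0.
apply: le_trans le_ln; rewrite lnXn // -[X in _ <= X]mulr_natl ler_wpM2l //; lra.
Qed.

Lemma ln_le_trunc_log (R : realType) n : (0 < n)%N ->
  ln (n%:R : R) <= (trunc_log 2 n).+1%:R.
Proof.
move=> n_gt0; have lt_n := trunc_log_ltn n (isT : 1 < 2)%N.
have ln2 : ln (2 : R) <= 1.
  by have := @le_ln1Dx R 1; have -> : 1 + 1 = 2 :> R by []; apply; lra.
apply: (@le_trans _ _ (ln (2 ^+ (trunc_log 2 n).+1))).
  by rewrite ler_ln ?posrE ?ltr0n ?exprn_gt0 // -natrX ler_nat ltnW.
by rewrite lnXn // -[X in _ <= X]mulr1 -[X in X <= _]mulr_natl ler_wpM2l.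
Qed.

(** With [b] the inner rounded logarithm, ln n is at least 2^(b-1), so ln ln n is at least (b-1)/2;
    this is at least (b+1)/4 because [3 <= b]. *)
Lemma lnln_ge (R : realType) n : (8 <= trunc_log 2 n)%N ->
  (trunc_log 2 (trunc_log 2 n)).+1%:R / 4 <= ln (ln (n%:R : R)).
Proof.
set lam := trunc_log 2 n => lam_ge; set b := trunc_log 2 lam.
have b_ge : (3 <= b)%N by apply: trunc_log_max.
have n_gt0 : (0 < n)%N by case: n @lam @b lam_ge b_ge.
have lam_n : (2 ^ lam <= n)%N by apply: trunc_logP.
have b_lam : (2 ^ b <= lam)%N by apply: trunc_logP => //; lia.
have ln_n : lam%:R / 2 <= ln (n%:R : R) by apply: ln_exp2_ge; rewrite -natrX ler_nat.
have : 2 ^+ b.-1 <= ln (n%:R : R).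
  apply: le_trans ln_n; rewrite ler_pdivlMr // -exprSr prednK; last by lia.
  by rewrite -natrX ler_nat.
move/ln_exp2_ge; apply: le_trans.
have : b.+1%:R <= 2 * b.-1%:R :> R by rewrite -natrM ler_nat; lia.
lra.
Qed.

Lemma nat_bound (R : realType) (K : R) : exists k : nat, K <= k%:R.
Proof.
exists (Num.bound `|K|); apply: le_trans (ler_norm K) _.
exact/ltW/archi_boundP.
Qed.

Theorem theorem17 (R : realType) (alpha : repetitiveness) (op : operation)
    (D : static_ds (query op) (answer op)) :
  supports D ->
  logarithmic_words R D ->
  polylog_space R alpha D ->
  exists (eps : R) (n0 : nat), 0 < eps /\
    forall n : nat, (n0 <= n)%N -> ~~ odd n ->
      exists (S : seq bool) (q : query op) (a : answer op),
        [/\ balanced S, size S = n, op_spec S q a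
          & eps * (ln n%:R / ln (ln n%:R)) <= (query_time D S q)%:R].
Proof.
move=> supD [Kw [n1 le_word]] [Ks [c [n2 le_space]]].
have [kw le_kw] := nat_bound Kw; have [ks le_ks] := nat_bound Ks.
have lnn_ge0 n : 0 <= ln (n%:R : R).
  by case: n => [|n]; [rewrite ln0 | apply: ln_ge0; rewrite ler1n].
(* Both space hypotheses pass to natural numbers: constants are rounded up and ln n is bounded by
   the bit length. The [+ 1] keeps [n] positive. *)
have word n : (maxn n1 n2 + 1 <= n)%N -> (word_size D n <= kw * (trunc_log 2 n).+1)%N.
  move=> le_n; rewrite -(@ler_nat R) natrM.
  apply: le_trans (le_word n _) _; first by lia.
  apply: (@le_trans _ _ (kw%:R * ln n%:R)); first by rewrite ler_wpM2r ?lnn_ge0.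
  by rewrite ler_wpM2l // ln_le_trunc_log; lia.
have space S a :
    balanced S -> (maxn n1 n2 + 1 <= size S)%N -> measure_value alpha S a ->
    (size (memory D S) <= ks * a * (trunc_log 2 (size S)).+1 ^ c)%N.
  move=> bS le_n Sa; rewrite -(@ler_nat R) !natrM natrX.
  apply: le_trans (le_space S a bS _ Sa) _; first by lia.
  apply: (@le_trans _ _ (ks%:R * a%:R * ln (size S)%:R ^+ c)).
    by rewrite ler_wpM2r ?exprn_ge0 ?lnn_ge0 // ler_wpM2r.
  rewrite ler_wpM2l ?mulr_ge0 // lerXn2r ?nnegrE //.
  by apply: ln_le_trunc_log; lia.
have [n0 hard] := hard_query_asymptotic supD word space.
have e_gt0 : 0 < 32 * (c + 8)%:R :> R by rewrite mulr_gt0 // ltr0n addn_gt0 orbT.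
(* The 32 is the 8 of the bound over the naturals times the 4 of [lnln_ge]; [2 ^ 8] ensures the
   hypothesis of the latter. *)
exists (32 * (c + 8)%:R)^-1, (n0 + 2 ^ 8)%N; split; first by rewrite invr_gt0.
move=> n le_n even_n.
have [||S [q [a [bS szS spec le_tau]]]] := hard n; [by lia | by [] |].
exists S, q, a; split=> //.
have lam_ge : (8 <= trunc_log 2 n)%N by apply: trunc_log_max => //; lia.
have le_lnln := @lnln_ge R n lam_ge.
set beta := (trunc_log 2 (trunc_log 2 n)).+1 in le_tau le_lnln.
have beta_gt0 : 0 < beta%:R :> R by rewrite ltr0n.
have lnln_gt0 : 0 < ln (ln (n%:R : R)).
  by apply: lt_le_trans le_lnln; rewrite divr_gt0 ?ltr0n.
rewrite mulrC (ler_pdivrMr _ _ e_gt0) (ler_pdivrMr _ _ lnln_gt0).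
apply: le_trans (ln_le_trunc_log R _) _; first by lia.
set tau := query_time D S q in le_tau *.
apply: (@le_trans _ _ (8 * beta * (c + 8) * tau)%N%:R); first by rewrite ler_nat.
have -> : (8 * beta * (c + 8) * tau)%N%:R =
          tau%:R * (32 * (c + 8)%:R) * (beta%:R / 4) :> R.
  by rewrite !natrM; field.
by rewrite ler_wpM2l // !mulr_ge0.
Qed.
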